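(* Let $\Pi=|00\rangle\langle00|+|01\rangle\langle10|+|10\rangle\langle01|+|11\rangle\langle11|$ be the two-qubit SWAP operator and take phase shift $\varphi=0$. (i) If $L$ belongs to the phase-locking-enforcing class $\mathcal C_1(0)$ or $\mathcal C_2(0)$, then every attractor $X$ of the semigroup generated by $L$ and $H$ satisfies $\Pi X\Pi=X$; consequently the asymptotic state is permutation invariant for every initial state. (ii) If $L$ belongs to $\mathcal C_{\pi/4}(0)$ or $\mathcal C_{-\pi/4}(0)$, then the only elements $X$ of the attractor space satisfying $\Pi X\Pi=X$ are the multiples of the identity; hence no asymptotic state other than the maximally mixed state is permutation invariant.
   Context: Hilbert space $\mathbb{C}^2\otimes\mathbb{C}^2$, $|ij\rangle=|i\rangle\otimes|j\rangle$; matrices are in the ordered basis $(|00\rangle,|01\rangle,|10\rangle,|11\rangle)$. $H=H_0\otimes I+I\otimes H_0$ with $H_0=\mathrm{diag}(E_0,E_1)$, $E_0,E_1\in\mathbb{R}$, $\Delta E=E_0-E_1\neq0$. The generator is $\mathcal L(\rho)=-i[H,\rho]+L\rho L^\dagger-\frac12\{L^\dagger L,\rho\}$. The attractor space is the direct sum of $\ker(\mathcal L-\lambda I)$ over all purely imaginary eigenvalues $\lambda$ (including $0$) of $\mathcal L$; its elements are called attractors, and asymptotic states are the density operators in it. Classes. $\mathcal C_1(\varphi)$: operators $T_1\begin{pmatrix} c&0&0&0\\ 0&c&0&0\\ 0&0&a&b\\ 0&0&e^{2ik}\bar b&a+me^{ik}\end{pmatrix}T_1^\dagger$, $T_1=\begin{pmatrix}1&0&0&0\\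 0&\frac1{\sqrt2}&\frac1{\sqrt2}&0\\ 0&\frac{e^{i\varphi}}{\sqrt2}&-\frac{e^{i\varphi}}{\sqrt2}&0\\ 0&0&0&1\end{pmatrix}$, with $a,b\in\mathbb{C}$, $c,k,m\in\mathbb{R}$, and $b\neq0$ or ($a\neq c$ and $m\neq0$). $\mathcal C_2(\varphi)$: operators $T_2\begin{pmatrix} a&b&0&0\\ e^{2ik}\bar b&a+me^{ik}&0&0\\ 0&0&c&0\\ 0&0&0&c\end{pmatrix}T_2^\dagger$, $T_2=\begin{pmatrix}1&0&0&0\\ 0&\frac1{\sqrt2}&\frac1{\sqrt2}&0\\ 0&-\frac{e^{i\varphi}}{\sqrt2}&\frac{e^{i\varphi}}{\sqrt2}&0\\ 0&0&0&1\end{pmatrix}$, with $a,b\in\mathbb{C}$, $c,k,m\in\mathbb{R}$, and $b\neq0$ or ($a+me^{ik}\neq c$ and $m\neq0$). $\mathcal C_\theta(\varphi)$: operators $T_\theta\begin{pmatrix} a&b&0&0\\ e^{2ik}\bar b&a+me^{ik}&0&0\\ 0&0&a&e^{-2i\theta}b\\ 0&0&e^{2i\theta}e^{2ik}\bar b&a+me^{ik}\end{pmatrix}T_\theta^\dagger$, $T_\theta=\begin{pmatrix}1&0&0&0\\ 0&ie^{-i\varphi}\sin\theta&\cos\theta&0\\ 0&-\cos\theta&-ie^{i\varphi}\sin\theta&0\\ 0&0&0&1\end{pmatrix}$, with $a,b\in\mathbb{C}$, $b\neq0$, $k,m\in\mathbb{R}$. *)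

(* Defs.v *)
From HB Require Import structures.
From mathcomp Require Import all_boot all_order all_algebra.
From mathcomp Require Import all_classical all_reals all_analysis.
From mathcomp Require Import complex mxtens.

Set Implicit Arguments.
Unset Strict Implicit.
Unset Printing Implicit Defensive.

Import Order.TTheory GRing.Theory Num.Theory.
Import numFieldNormedType.Exports.

Local Open Scope classical_set_scope.
Local Open Scope ring_scope.
Local Open Scope complex_scope.

(* Operators on C^2 (x) C^2 are 4 x 4 matrices over R[i], in the ordered basis
   |00>, |01>, |10>, |11>; this is the ordering produced by the Kronecker
   product tensmx. *)

Definition adjmx (R : rcfType) (m n : nat) (A : 'M[R[i]]_(m, n)) : 'M[R[i]]_(n, m) :=
  map_mx (@conjc R) A^T.

Definition mx4 (K : nzRingType) (rows : seq (seq K)) : 'M[K]_4 :=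
  \matrix_(i < 4, j < 4) nth 0 (nth [::] rows i) j.

Definition commutator (K : pzRingType) (n : nat) (A B : 'M[K]_n) : 'M[K]_n :=
  A *m B - B *m A.

Definition anticommutator (K : pzRingType) (n : nat) (A B : 'M[K]_n) : 'M[K]_n :=
  A *m B + B *m A.

Definition expi (R : realType) (x : R) : R[i] := cos x +i* sin x.

Fact lin_comb3 (K : comPzRingType) (V : lmodType K) (a x y : K)
    (A1 A2 D1 D2 B1 B2 : V) :
  - (x *: (a *: A1 + A2)) + (a *: D1 + D2) - y *: (a *: B1 + B2)
  = a *: (- (x *: A1) + D1 - y *: B1) + (- (x *: A2) + D2 - y *: B2).
Proof.
rewrite !(scalerDr, scalerN) !opprD !scalerA [x * a]mulrC [y * a]mulrC.
by rewrite [in RHS]addrACA; congr (_ + _); rewrite [in LHS]addrACA.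
Qed.

Section Lindblad.
Context {R : realType}.
Local Notation C := R[i].
Implicit Types (H L X rho : 'M[C]_4).

Definition lindbladian H L rho : 'M[C]_4 :=
  - ('i *: commutator H rho) + L *m rho *m adjmx L
  - 2^-1 *: anticommutator (adjmx L *m L) rho.

Lemma lindbladian_is_linear H L : linear (lindbladian H L).
Proof.
move=> a X Y; rewrite /lindbladian.
have -> : commutator H (a *: X + Y) = a *: commutator H X + commutator H Y.
  by rewrite /commutator mulmxDr mulmxDl -scalemxAr -scalemxAl opprD scalerBr addrACA.
have -> : anticommutator (adjmx L *m L) (a *: X + Y)
  = a *: anticommutator (adjmx L *m L) X + anticommutator (adjmx L *m L) Y.
  by rewrite /anticommutator mulmxDr mulmxDl -scalemxAr -scalemxAl scalerDr addrACA.
rewrite mulmxDr mulmxDl -scalemxAr -scalemxAl.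
move: (commutator H X) (commutator H Y) => A1 A2.
move: (anticommutator _ X) (anticommutator _ Y) => B1 B2.
move: (L *m X *m _) (L *m Y *m _) => D1 D2.
exact: lin_comb3.
Qed.

HB.instance Definition _ H L :=
  GRing.isLinear.Build C 'M[C]_4 'M[C]_4 *:%R (lindbladian H L)
    (lindbladian_is_linear H L).

(* Sum of the spaces ker (Lindbladian - l) over purely imaginary l; it is
   automatically direct, and numbers l that are not eigenvalues contribute 0,
   so any finite list s of purely imaginary numbers may be used. *)
Definition attractor H L X : Prop :=
  exists2 s : seq C, {in s, forall l, complex.Re l = 0} &
    X \in (\sum_(l <- s) lker (linfun (lindbladian H L) - l *: \1%VF))%VS.

(* Over R[i], 0 <= z means that z is real and nonnegative, so positivity
   includes self-adjointness. *)
Definition density rho : Prop :=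
  (forall v : 'cV[C]_4, 0 <= (adjmx v *m rho *m v) 0 0) /\ \tr rho = 1.

Definition asymptotic_state H L rho : Prop := density rho /\ attractor H L rho.

(* t |-> rho t is, for t >= 0, the trajectory of the semigroup generated by
   lindbladian H L that starts at rho 0. *)
Definition trajectory H L (rho : R -> 'M[C]_4) : Prop :=
  forall i j : 'I_4,
    [/\ complex.Re (rho t i j) @[t --> 0^'+] --> complex.Re (rho 0 i j),
        complex.Im (rho t i j) @[t --> 0^'+] --> complex.Im (rho 0 i j) &
        forall t : R, 0 < t ->
          is_derive t 1 (fun u => complex.Re (rho u i j))
            (complex.Re (lindbladian H L (rho t) i j)) /\
          is_derive t 1 (fun u => complex.Im (rho u i j))
            (complex.Im (lindbladian H L (rho t) i j))].

Definition hamiltonian1 (E0 E1 : R) : 'M[C]_2 :=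
  diag_mx (\row_(j < 2) (if j == 0 then E0 else E1)%:C).

Definition hamiltonian (E0 E1 : R) : 'M[C]_4 :=
  tensmx (hamiltonian1 E0 E1) 1%:M + tensmx 1%:M (hamiltonian1 E0 E1).

Definition ket (i j : 'I_2) : 'cV[C]_4 :=
  tensmx (delta_mx i 0 : 'cV[C]_2) (delta_mx j 0 : 'cV[C]_2).

Definition swap : 'M[C]_4 :=
  ket 0 0 *m adjmx (ket 0 0) + ket 0 1 *m adjmx (ket 1 0)
  + ket 1 0 *m adjmx (ket 0 1) + ket 1 1 *m adjmx (ket 1 1).

Definition perm_invariant X : Prop := swap *m X *m swap = X.

Local Notation rsqrt2 := ((Num.sqrt 2 : R)^-1%:C).

Definition T1 (phi : R) : 'M[C]_4 := mx4
  [:: [:: 1; 0;                    0;                         0];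
      [:: 0; rsqrt2;               rsqrt2;                    0];
      [:: 0; expi phi * rsqrt2;    - (expi phi * rsqrt2);     0];
      [:: 0; 0;                    0;                         1]].

Definition T2 (phi : R) : 'M[C]_4 := mx4
  [:: [:: 1; 0;                      0;                  0];
      [:: 0; rsqrt2;                 rsqrt2;             0];
      [:: 0; - (expi phi * rsqrt2);  expi phi * rsqrt2;  0];
      [:: 0; 0;                      0;                  1]].

Definition Ttheta (theta phi : R) : 'M[C]_4 := mx4
  [:: [:: 1; 0;                                   0;                                  0];
      [:: 0; 'i * expi (- phi) * (sin theta)%:C;  (cos theta)%:C;                     0];
      [:: 0; - (cos theta)%:C;                    - ('i * expi phi * (sin theta)%:C); 0];
      [:: 0; 0;                                   0;                                  1]].

Definition class1 (phi : R) L : Prop :=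
  exists (a b : C) (c k m : R),
    (b != 0 \/ (a != c%:C /\ m != 0)) /\
    L = T1 phi *m mx4
          [:: [:: c%:C; 0;    0;                    0];
              [:: 0;    c%:C; 0;                    0];
              [:: 0;    0;    a;                    b];
              [:: 0;    0;    expi (2 * k) * conjc b;   a + m%:C * expi k]]
        *m adjmx (T1 phi).

Definition class2 (phi : R) L : Prop :=
  exists (a b : C) (c k m : R),
    (b != 0 \/ (a + m%:C * expi k != c%:C /\ m != 0)) /\
    L = T2 phi *m mx4
          [:: [:: a;                   b;                  0;    0];
              [:: expi (2 * k) * conjc b;  a + m%:C * expi k;  0;    0];
              [:: 0;                   0;                  c%:C; 0];
              [:: 0;                   0;                  0;    c%:C]]
        *m adjmx (T2 phi).

Definition class_theta (theta phi : R) L : Prop :=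
  exists (a b : C) (k m : R),
    b != 0 /\
    L = Ttheta theta phi *m mx4
          [:: [:: a;                   b;                  0; 0];
              [:: expi (2 * k) * conjc b;  a + m%:C * expi k;  0; 0];
              [:: 0; 0; a; expi (- (2 * theta)) * b];
              [:: 0; 0; expi (2 * theta) * expi (2 * k) * conjc b; a + m%:C * expi k]]
        *m adjmx (Ttheta theta phi).

End Lindblad.

(* Main.v *)
(* Every L in these classes is normal, which for the real Hilbert-Schmidt form
   gives 2 <X, Lind X> = - |[L, X]|^2.  Hence an attractor X commutes with L and
   with L^*, so that Lind X = - i [H, X] and also [L, [H, X]] = 0.  In the basis
   T of the class, the linear equations [L, X] = [L, [H, X]] = 0 already force
   permutation invariance for C_1 and C_2, and X = M (x) 1 (in a basis mixed by
   SWAP) for C_theta; the angle plays no role once phi = 0.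

   For trajectories, |rho|^2 is a Lyapunov function whose derivative
   - |[L, rho]|^2 is uniformly continuous, so [L, rho t] -> 0 (Barbalat).  As
   Lind rho solves the same equation, [L, Lind (rho t)] -> 0 too.  The map
   X |-> SWAP X SWAP - X vanishes on the common kernel of these two linear maps,
   hence factors linearly through them and tends to 0 along rho. *)
From HB Require Import structures.
Require Import Defs.
From mathcomp Require Import all_boot all_order all_algebra.
From mathcomp Require Import all_classical all_reals all_analysis.
From mathcomp Require Import complex.
From mathcomp Require Import mxtens ring lra.

Import Order.TTheory GRing.Theory Num.Theory.
Import numFieldNormedType.Exports.

Local Open Scope classical_set_scope.
Local Open Scope ring_scope.
Local Open Scope complex_scope.

Set Implicit Arguments.
Unset Strict Implicit.
Unset Printing Implicit Defensive.

(** * Linearity of the commutator and sums of subspaces *)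

Lemma commutator_is_linear (K : comPzRingType) n (A : 'M[K]_n) :
  linear (commutator A).
Proof.
move=> a B D; rewrite /commutator mulmxDr mulmxDl -scalemxAr -scalemxAl.
by rewrite opprD addrACA scalerBr.
Qed.

HB.instance Definition _ (K : comPzRingType) n (A : 'M[K]_n) :=
  GRing.isLinear.Build K 'M[K]_n 'M[K]_n *:%R (commutator A)
    (commutator_is_linear A).

Lemma commutatorDr (K : comPzRingType) n (A B D : 'M[K]_n) :
  commutator A (B + D) = commutator A B + commutator A D.
Proof. exact: linearD. Qed.

(** A vector in a sum of subspaces splits into one vector per summand, so closure under addition is
    enough to pass from the summands to the sum. This reduces claims about attractors to
    eigenvectors. *)
Lemma sumv_sub_invariant (K : fieldType) (V : vectType K) (P : V -> Prop)
    (s : seq K) (U : K -> {vspace V}) :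
  P 0 -> (forall x y, P x -> P y -> P (x + y)) ->
  {in s, forall l x, x \in U l -> P x} ->
  forall x, x \in (\sum_(l <- s) U l)%VS -> P x.
Proof.
move=> P0 PD; elim: s => [|l s IHs] PU x.
  by rewrite big_nil memv0 => /eqP ->.
rewrite big_cons => /memv_addP[u ul [v vs ->]]; apply: PD.
  by apply: PU ul; rewrite inE eqxx.
by apply: IHs vs => k ks; apply: PU; rewrite inE ks orbT.
Qed.

(** * The adjoint and the real Hilbert-Schmidt form *)

Section Adjoint.
Context {R : rcfType}.
Local Notation C := R[i].

Lemma adjmxE m n (A : 'M[C]_(m, n)) i j : adjmx A i j = (A j i)^*.
Proof. by rewrite !mxE. Qed.

Lemma adjmxK m n (A : 'M[C]_(m, n)) : adjmx (adjmx A) = A.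
Proof. by apply/matrixP => i j; rewrite !adjmxE conjcK. Qed.

Lemma adjmxM m n p (A : 'M[C]_(m, n)) (B : 'M[C]_(n, p)) :
  adjmx (A *m B) = adjmx B *m adjmx A.
Proof. by rewrite /adjmx trmx_mul map_mxM. Qed.

End Adjoint.

Section FrobeniusForm.
Context {R : rcfType}.
Local Notation C := R[i].

(** The Euclidean inner product of the underlying real space. Taking the real part makes
    multiplication by ['i] skew and keeps squared norms, their limits and their derivatives in
    [R]. *)
Definition rdot m n (A B : 'M[C]_(m, n)) : R :=
  complex.Re (\tr (adjmx A *m B)).

Lemma rdotE m n (A B : 'M[C]_(m, n)) :
  rdot A B = \sum_j \sum_i (complex.Re (A i j) * complex.Re (B i j)
                            + complex.Im (A i j) * complex.Im (B i j)).
Proof.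
have ReS (I : finType) (F : I -> C) :
    complex.Re (\sum_i F i) = \sum_i complex.Re (F i).
  by apply: (big_morph (@complex.Re R)) => // -[? ?] [? ?].
rewrite /rdot /mxtrace ReS; apply: eq_bigr => j _.
rewrite mxE ReS; apply: eq_bigr => i _.
by rewrite adjmxE; case: (A i j) (B i j) => [a b] [c d] /=; rewrite mulNr opprK.
Qed.

Lemma rdotC m n (A B : 'M[C]_(m, n)) : rdot A B = rdot B A.
Proof.
rewrite !rdotE; apply: eq_bigr => j _; apply: eq_bigr => i _.
by congr (_ + _); rewrite mulrC.
Qed.

Lemma rdotDr m n (A B D : 'M[C]_(m, n)) : rdot A (B + D) = rdot A B + rdot A D.
Proof.
by rewrite /rdot mulmxDr mxtraceD; case: (\tr _) (\tr _) => ? ? [? ?].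
Qed.

Lemma rdotNr m n (A B : 'M[C]_(m, n)) : rdot A (- B) = - rdot A B.
Proof. by rewrite /rdot mulmxN linearN /=; case: (\tr _). Qed.

Lemma rdotBr m n (A B D : 'M[C]_(m, n)) : rdot A (B - D) = rdot A B - rdot A D.
Proof. by rewrite rdotDr rdotNr. Qed.

Lemma rdotDl m n (A B D : 'M[C]_(m, n)) : rdot (A + B) D = rdot A D + rdot B D.
Proof. by rewrite rdotC rdotDr rdotC [rdot D B]rdotC. Qed.

Lemma rdotBl m n (A B D : 'M[C]_(m, n)) : rdot (A - B) D = rdot A D - rdot B D.
Proof. by rewrite rdotC rdotBr rdotC [rdot D B]rdotC. Qed.

Lemma rdotZr m n (k : R) (A B : 'M[C]_(m, n)) :
  rdot A (k%:C *: B) = k * rdot A B.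
Proof.
rewrite /rdot -scalemxAr mxtraceZ; case: (\tr _) => a b /=.
by rewrite mul0r subr0.
Qed.

Lemma rdot_iN m n (A B : 'M[C]_(m, n)) : rdot A ('i *: B) = - rdot ('i *: A) B.
Proof.
rewrite !rdotE -sumrN; apply: eq_bigr => j _; rewrite -sumrN.
apply: eq_bigr => i _; rewrite !mxE.
by case: (A i j) (B i j) => [a b] [c d] /=; ring.
Qed.

Lemma rdot_iself m n (A : 'M[C]_(m, n)) : rdot A ('i *: A) = 0.
Proof. by have := rdot_iN A A; rewrite [X in _ = - X]rdotC; lra. Qed.

Lemma rdotMr m n p (A : 'M[C]_(m, p)) (B : 'M[C]_(m, n)) (D : 'M[C]_(n, p)) :
  rdot A (B *m D) = rdot (adjmx B *m A) D.
Proof. by rewrite /rdot adjmxM adjmxK mulmxA. Qed.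

Lemma rdotMl m n p (A : 'M[C]_(m, p)) (B : 'M[C]_(m, n)) (D : 'M[C]_(n, p)) :
  rdot A (B *m D) = rdot (A *m adjmx D) B.
Proof. by rewrite /rdot adjmxM adjmxK mulmxA mxtrace_mulC mulmxA. Qed.

Lemma rdot_ge0 m n (A : 'M[C]_(m, n)) : 0 <= rdot A A.
Proof.
rewrite rdotE; apply: sumr_ge0 => j _; apply: sumr_ge0 => i _.
by rewrite -!expr2 addr_ge0 ?sqr_ge0.
Qed.

Lemma normc_le_rdot m n (A : 'M[C]_(m, n)) i j :
  Normc.normc (A i j) ^+ 2 <= rdot A A.
Proof.
have pos k l : 0 <= complex.Re (A k l) * complex.Re (A k l)
                    + complex.Im (A k l) * complex.Im (A k l).
  by rewrite -!expr2 addr_ge0 ?sqr_ge0.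
rewrite rdotE (bigD1 j) //= (bigD1 i) //= -addrA.
have -> : Normc.normc (A i j) ^+ 2 = complex.Re (A i j) * complex.Re (A i j)
                    + complex.Im (A i j) * complex.Im (A i j).
  case: (A i j) => a b /=.
  by rewrite sqr_sqrtr ?addr_ge0 ?sqr_ge0 // !expr2.
rewrite lerDl addr_ge0 // sumr_ge0 // => l _.
by rewrite sumr_ge0.
Qed.

Lemma rdot_eq0 m n (A : 'M[C]_(m, n)) : rdot A A = 0 -> A = 0.
Proof.
move=> A0; apply/matrixP => i j; rewrite mxE.
apply: Normc.eq0_normc; apply/eqP; rewrite -sqrf_eq0 eq_le sqr_ge0 andbT.
by rewrite -A0 normc_le_rdot.
Qed.

Lemma rdotD_le m n (A B : 'M[C]_(m, n)) :
  rdot (A + B) (A + B) <= 2 * (rdot A A + rdot B B).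
Proof.
have := rdot_ge0 (A - B).
rewrite rdotBl !rdotBr rdotDl !rdotDr (rdotC B A).
by move: (rdot A A) (rdot A B) (rdot B B) => u v w; lra.
Qed.

Lemma rdotZZ m n (k : C) (A : 'M[C]_(m, n)) :
  rdot (k *: A) (k *: A) = Normc.normc k ^+ 2 * rdot A A.
Proof.
rewrite !rdotE mulr_sumr; apply: eq_bigr => j _; rewrite mulr_sumr.
apply: eq_bigr => i _; rewrite mxE.
case: k (A i j) => [a b] [c d] /=.
rewrite sqr_sqrtr ?addr_ge0 ?sqr_ge0 //; ring.
Qed.

(** Linear maps in finite dimension are bounded: expand [X] in matrix units, bound each term by
    [normc_le_rdot], and use that bounded maps are closed under finite sums. *)
Lemma rdot_linear_bound m n p q (F : {linear 'M[C]_(m, n) -> 'M[C]_(p, q)}) :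
  exists2 K : R, 0 <= K & forall X, rdot (F X) (F X) <= K * rdot X X.
Proof.
pose bounded (G : 'M[C]_(m, n) -> 'M[C]_(p, q)) :=
  exists2 K : R, 0 <= K & forall X, rdot (G X) (G X) <= K * rdot X X.
have bD G1 G2 : bounded G1 -> bounded G2 -> bounded (fun X => G1 X + G2 X).
  move=> [K1 K10 h1] [K2 K20 h2]; exists (2 * (K1 + K2)).
    by rewrite mulr_ge0 ?addr_ge0.
  move=> X; apply: le_trans (rdotD_le _ _) _.
  by rewrite -mulrA ler_wpM2l // mulrDl lerD.
have bS (I : Type) (s : seq I) (G : I -> 'M[C]_(m, n) -> 'M[C]_(p, q)) :
    (forall i, bounded (G i)) -> bounded (fun X => \sum_(i <- s) G i X).
  move=> bG; elim: s => [|i s IHs].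
    exists 0 => // X; rewrite big_nil mul0r rdotE big1 // => j _.
    by rewrite big1 // => k _; rewrite !mxE /= !mul0r addr0.
  under [X in bounded X]funext => X do rewrite big_cons.
  exact: bD.
suff: bounded F by [].
have -> : F = (fun X => \sum_i \sum_j X i j *: F (delta_mx i j)) :> (_ -> _).
  apply/funext => X; rewrite {1}[X]matrix_sum_delta linear_sum.
  apply: eq_bigr => i _; rewrite linear_sum; apply: eq_bigr => j _.
  by rewrite linearZ.
apply: (bS) => i; apply: (bS) => j.
exists (rdot (F (delta_mx i j)) (F (delta_mx i j))); first exact: rdot_ge0.
move=> X; rewrite rdotZZ mulrC ler_wpM2l ?rdot_ge0 //.
exact: normc_le_rdot.
Qed.

End FrobeniusForm.

(** * Attractors of a Lindbladian with normal [L] and Hermitian [H] *)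

Lemma half_half (F : numFieldType) : 2^-1 + 2^-1 = 1 :> F.
Proof. by rewrite [RHS]splitr !mul1r. Qed.

Section NormalLindbladian.
Context {R : realType}.
Local Notation C := R[i].
Variables H L : 'M[C]_4.
Hypothesis hermH : adjmx H = H.
Hypothesis normL : adjmx L *m L = L *m adjmx L.

(** Expanding the square gives two diagonal terms and a cross term. Normality exchanges [L] and
    [adjmx L] in the diagonal terms, and moving both factors across the form does so in the cross
    term. In particular, commuting with [L] forces commuting with [adjmx L], as in Fuglede's
    theorem. *)
Lemma rdot_commutator_adj (X : 'M[C]_4) :
  rdot (commutator (adjmx L) X) (commutator (adjmx L) X)
  = rdot (commutator L X) (commutator L X).
Proof.
have e (A : 'M[C]_4) : rdot (commutator A X) (commutator A X)
    = rdot X (adjmx A *m A *m X) + rdot X (X *m (A *m adjmx A))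
      - 2 * rdot (A *m X) (X *m A).
  rewrite /commutator rdotBl !rdotBr [rdot (X *m A) (A *m X)]rdotC.
  have -> : rdot (A *m X) (A *m X) = rdot X (adjmx A *m A *m X).
    by rewrite -mulmxA [RHS]rdotMr adjmxK.
  have -> : rdot (X *m A) (X *m A) = rdot X (X *m (A *m adjmx A)).
    by rewrite mulmxA [RHS]rdotMl adjmxK.
  by move: (rdot _ _) (rdot _ _) (rdot _ _) => u v w; ring.
have cross : rdot (adjmx L *m X) (X *m adjmx L) = rdot (L *m X) (X *m L).
  by rewrite rdotMl (adjmxK L) [RHS]rdotC [RHS]rdotMr mulmxA.
apply: etrans (e (adjmx L)) _; rewrite [RHS]e cross (adjmxK L).
exact: (congr2 (fun U V => rdot X (U *m X) + rdot X (X *m V) - _)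
               (esym normL) normL).
Qed.

(** Multiplication by the Hermitian [H] on either side is self-adjoint and ['i] is skew, so the
    Hamiltonian part contributes 0. In the dissipator, normality rewrites [X *m (adjmx L *m L)] so
    that the three terms complete the square of [L *m X - X *m L]. *)
Lemma rdot_lindbladian (X : 'M[C]_4) :
  2 * rdot X (lindbladian H L X) = - rdot (commutator L X) (commutator L X).
Proof.
have h0 : rdot X ('i *: commutator H X) = 0.
  have hl : rdot X ('i *: (H *m X)) = 0.
    have : rdot X ('i *: (H *m X)) = - rdot X ('i *: (H *m X)).
      rewrite {1}rdot_iN; congr (- _).
      by rewrite rdotMr hermH -scalemxAr rdotC.
    by move: (rdot _ _) => u ?; lra.
  have hr : rdot X ('i *: (X *m H)) = 0.
    have : rdot X ('i *: (X *m H)) = - rdot X ('i *: (X *m H)).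
      rewrite {1}rdot_iN; congr (- _).
      by rewrite rdotMl hermH -scalemxAl rdotC.
    by move: (rdot _ _) => u ?; lra.
  by rewrite /commutator scalerBr rdotBr hl hr subrr.
have h2 : (2^-1 : C) = (2^-1 : R)%:C by rewrite fmorphV rmorph_nat.
rewrite /lindbladian /anticommutator h2 !rdotBr rdotDr rdotNr h0 rdotZr rdotDr.
rewrite !rdotBl [rdot (X *m L) (L *m X)]rdotC.
have -> : rdot X (L *m X *m adjmx L) = rdot (L *m X) (X *m L).
  by rewrite rdotMl adjmxK rdotC.
have -> : rdot X (adjmx L *m L *m X) = rdot (L *m X) (L *m X).
  by rewrite -mulmxA rdotMr adjmxK.
have -> : rdot X (X *m (adjmx L *m L)) = rdot (X *m L) (X *m L).
  by rewrite normL mulmxA rdotMl adjmxK.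
by move: (rdot _ _) (rdot _ _) (rdot _ _) => u v w; lra.
Qed.

(** Since [X] then also commutes with [adjmx L], both halves of the anticommutator equal
    [L *m X *m adjmx L], and the dissipator cancels. *)
Lemma lindbladian_commuting (X : 'M[C]_4) :
  commutator L X = 0 -> lindbladian H L X = - ('i *: commutator H X).
Proof.
move=> LX0; have := rdot_commutator_adj X.
rewrite LX0 {2}/rdot mulmx0 mxtrace0 => /rdot_eq0 LaX0.
have LX : L *m X = X *m L := subr0_eq LX0.
have LaX : adjmx L *m X = X *m adjmx L := subr0_eq LaX0.
rewrite /lindbladian /anticommutator.
move: (adjmx L) normL LaX => D DL DX.
have -> : X *m (D *m L) = L *m X *m D by rewrite DL mulmxA -LX.
have -> : D *m L *m X = L *m X *m D.
  by rewrite -(mulmxA D) LX (mulmxA D) DX -!(mulmxA X) DL.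
move: (L *m X *m D) ('i *: _) => Y Z.
by rewrite scalerDr -scalerDl half_half scale1r addrK.
Qed.

Lemma commutator_lindbladian_eq0 (X : 'M[C]_4) :
  commutator L X = 0 -> commutator L (lindbladian H L X) = 0 ->
  commutator L (commutator H X) = 0.
Proof.
move=> LX0; rewrite (lindbladian_commuting LX0).
move: (commutator H X) => Y; rewrite linearN linearZ /=.
move/eqP; rewrite oppr_eq0 scaler_eq0 => /orP[/eqP[e]|/eqP //].
by case/eqP: (oner_neq0 R).
Qed.

(** For imaginary [l] the form of [X] against [l *: X] is 0 by skewness of ['i], so the dissipation
    of [X] vanishes. The second equation follows because the Lindbladian maps [X] to a multiple of
    itself. *)
Lemma imaginary_eigenvector_commuting (l : C) (X : 'M[C]_4) :
  complex.Re l = 0 -> lindbladian H L X = l *: X ->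
  commutator L X = 0 /\ commutator L (commutator H X) = 0.
Proof.
case: l => a b /= -> XE.
have LX0 : commutator L X = 0.
  apply/rdot_eq0/eqP; rewrite -oppr_eq0 -rdot_lindbladian XE.
  have -> : 0 +i* b = b%:C * 'i :> C by simpc.
  by rewrite -scalerA rdotZr rdot_iself !mulr0.
split; first exact: LX0.
apply: (commutator_lindbladian_eq0 LX0).
by rewrite XE linearZ /= LX0 scaler0.
Qed.

Lemma attractor_commuting (X : 'M[C]_4) : attractor H L X ->
  commutator L X = 0 /\ commutator L (commutator H X) = 0.
Proof.
have PD (A B : 'M[C]_4) :
    commutator L A = 0 /\ commutator L (commutator H A) = 0 ->
    commutator L B = 0 /\ commutator L (commutator H B) = 0 ->
    commutator L (A + B) = 0 /\ commutator L (commutator H (A + B)) = 0.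
  move=> [A0 A1] [B0 B1].
  have -> : commutator H (A + B) = _ := commutatorDr H A B.
  split; first by apply: etrans (commutatorDr L A B) _; rewrite A0 B0 addr0.
  exact: etrans (commutatorDr L _ _) (etrans (congr2 +%R A1 B1) (addr0 0)).
move=> [s sIm XS].
pose P (Y : 'M[C]_4) :=
  commutator L Y = 0 /\ commutator L (commutator H Y) = 0.
have P0 : P 0 by rewrite /P !linear0.
suff PX : P X by exact: PX.
apply: (sumv_sub_invariant P0 PD _ XS) => l ls {XS}X.
rewrite memv_ker add_lfunE opp_lfunE scale_lfunE id_lfunE lfunE subr_eq0.
by move=> /eqP /(imaginary_eigenvector_commuting (sIm l ls)).
Qed.

End NormalLindbladian.

(** * Explicit 4 x 4 matrices; SWAP and the Hamiltonian in coordinates *)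

Local Notation o0 := (@Ordinal 4 0 isT).
Local Notation o1 := (@Ordinal 4 1 isT).
Local Notation o2 := (@Ordinal 4 2 isT).
Local Notation o3 := (@Ordinal 4 3 isT).

Section Matrices4.

(** The cases are literal ordinals, so that [nth] lookups in matrix entries reduce by
    computation. *)
Lemma ord4_ind (P : 'I_4 -> Prop) :
  P o0 -> P o1 -> P o2 ->
  P o3 -> forall i, P i.
Proof.
move=> P0 P1 P2 P3 [[|[|[|[|//]]]] hi].
- by rewrite (_ : Ordinal hi = o0); last exact: val_inj.
- by rewrite (_ : Ordinal hi = o1); last exact: val_inj.
- by rewrite (_ : Ordinal hi = o2); last exact: val_inj.
- by rewrite (_ : Ordinal hi = o3); last exact: val_inj.
Qed.

Lemma sum_ord4 (V : nmodType) (F : 'I_4 -> V) :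
  \sum_i F i = F o0 + (F o1
               + (F o2 + F o3)).
Proof.
rewrite !big_ord_recl big_ord0 addr0.
by congr (F _ + (F _ + (F _ + F _))); exact: val_inj.
Qed.

Lemma mx4E (K : nzRingType) (rows : seq (seq K)) (i j : 'I_4) :
  mx4 rows i j = nth 0 (nth [::] rows i) j.
Proof. by rewrite mxE. Qed.

Lemma mulmx4E (K : nzRingType) (A B : 'M[K]_4) (i j : 'I_4) :
  (A *m B) i j = A i o0 * B o0 j
    + (A i o1 * B o1 j
    + (A i o2 * B o2 j
    + A i o3 * B o3 j)).
Proof. by rewrite mxE sum_ord4. Qed.

(* Up to an affine change, the energies of |00>, |01>, |10>, |11>. *)
Definition charge (F : pzRingType) (i : 'I_4) : F := [:: 1; 0; 0; -1]`_i.

End Matrices4.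

Section QubitMatrices.
Context {R : realType}.
Local Notation C := R[i].

Lemma ketE (i j : 'I_2) :
  ket i j = delta_mx (mxtens_index (i, j)) 0 :> 'cV[C]_4.
Proof.
apply/matrixP => k l; case: (@mxtens_indexP 2 2 k) => p q.
have l0 : l = mxtens_index ((0, 0) : 'I_1 * 'I_1).
  by rewrite ord1; apply: val_inj.
apply: etrans (congr1 (ket i j _) l0) _; apply: etrans (tensmxE _ _ _ _ _ _) _.
rewrite (ord1 l) !mxE (can_eq (@mxtens_indexK _ _)) xpair_eqE /=.
by rewrite !andbT -natrM mulnb.
Qed.

Lemma adjmx_delta m n i j :
  adjmx (delta_mx i j : 'M[C]_(m, n)) = delta_mx j i.
Proof. by rewrite /adjmx trmx_delta map_delta_mx. Qed.

Lemma swapE : swap = mx4 [:: [:: 1; 0; 0; 0]; [:: 0; 0; 1; 0];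
                             [:: 0; 1; 0; 0]; [:: 0; 0; 0; 1]] :> 'M[C]_4.
Proof.
rewrite /swap !ketE !adjmx_delta !mul_delta_mx.
apply/matrixP => i j; rewrite mx4E !mxE -!val_eqE /=.
move: i j; elim/ord4_ind; elim/ord4_ind => /=; rewrite ?addr0 ?add0r //.
Qed.

Lemma charge_real (k : 'I_4) : charge C k = (charge R k)%:C.
Proof. by elim/ord4_ind: k => //=; rewrite /charge /= rmorphN1. Qed.

(** The energies 2 E0, E0 + E1, E0 + E1, 2 E1 are affine in the charge with slope E0 - E1, so a
    commutator with the Hamiltonian multiplies each entry by E0 - E1 times a difference of
    charges. *)
Lemma hamiltonianE (E0 E1 : R) : hamiltonian E0 E1 =
  diag_mx (\row_j ((E0 + E1)%:C + (E0 - E1)%:C * charge C j)).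
Proof.
apply/matrixP => i j.
case: (@mxtens_indexP 2 2 i) => p q; case: (@mxtens_indexP 2 2 j) => r s.
rewrite /hamiltonian mxE !tensmxE !mxE.
have -> : (mxtens_index (p, q) == mxtens_index (r, s) :> 'I_4)
          = (p == r) && (q == s).
  by rewrite -xpair_eqE; exact: (can_eq (@mxtens_indexK 2 2)).
case: (p == r) (q == s) => [] [];
  rewrite ?(mulr0, mul0r, mulr1, mul1r, mulr1n, mulr0n, addr0, add0r) //=.
rewrite charge_real -rmorphM -!rmorphD; congr (_ %:C).
by move: p q; do 2![case=> [[|[|//]] ?]] => /=; rewrite /charge /=; ring.
Qed.

End QubitMatrices.

(** * Solving the commutation equations entry by entry *)

Section CommutantEntries.
Context {F : numFieldType}.
Implicit Types (N Y : 'M[F]_4) (a b c d e s w : F).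

(** The commutator with the diagonal matrix is [w] times the charge-weighted matrix [Z]: the shift
    [s] cancels and the nonzero [w] is divided out, which leaves equations with integer weights. *)
Lemma commutator_charge N Y s w : w != 0 ->
  commutator N Y = 0 ->
  commutator N (commutator (diag_mx (\row_j (s + w * charge F j))) Y) = 0 ->
  (forall i j, N i o0 * Y o0 j + (N i o1 * Y o1 j
                  + (N i o2 * Y o2 j + N i o3 * Y o3 j))
             = Y i o0 * N o0 j + (Y i o1 * N o1 j
                  + (Y i o2 * N o2 j + Y i o3 * N o3 j))) /\
  let Z i j := (charge F i - charge F j) * Y i j in
  (forall i j, N i o0 * Z o0 j + (N i o1 * Z o1 j
                  + (N i o2 * Z o2 j + N i o3 * Z o3 j))
             = Z i o0 * N o0 j + (Z i o1 * N o1 j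
                  + (Z i o2 * N o2 j + Z i o3 * N o3 j))).
Proof.
move=> w0 NY NHY; split=> [i j|Z i j].
  by rewrite -!mulmx4E (subr0_eq NY).
have HZ : commutator (diag_mx (\row_j (s + w * charge F j))) Y
    = w *: \matrix_(i, j) Z i j.
  rewrite /commutator mul_diag_mx mul_mx_diag; apply/matrixP => k l.
  by rewrite !mxE /Z; ring.
move: NHY; rewrite HZ linearZ /= => /eqP.
rewrite scaler_eq0 (negPf w0) => /eqP/subr0_eq/matrixP/(_ i j).
by rewrite !mulmx4E !mxE.
Qed.

(** Certificate for linear elimination: [k1] and [k2] are the multipliers of two known equations,
    and [field] checks the resulting identity. *)
Lemma lincomb2 (k1 k2 x1 y1 x2 y2 z : F) :
  x1 = y1 -> x2 = y2 -> z = k1 * (x1 - y1) + k2 * (x2 - y2) -> z = 0.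
Proof. by move=> -> -> ->; rewrite !subrr !mulr0 addr0. Qed.
Arguments lincomb2 k1 k2 {x1 y1 x2 y2 z}.

Ltac comb E1 E2 k1 k2 :=
  apply: (lincomb2 k1 k2 E1 E2); rewrite !mx4E /charge /=; by field.

(** Lets one pair of identities serve both alternatives in the definition of a class: nonzero
    off-diagonal entries, or distinct diagonal entries. *)
Lemma mulf_cancel0 x y z :
  x != 0 \/ y != 0 -> z * x = 0 -> z * y = 0 -> z = 0 :> F.
Proof.
case=> /negPf n0 /eqP hx /eqP hy; apply/eqP; move: hx hy.
  by rewrite !mulf_eq0 n0 orbF.
by rewrite !mulf_eq0 n0 orbF.
Qed.

(* Only the two equations of order 0 and 1 in the charge are needed: in each
   matrix entry, a combination of the two isolates a single unknown. *)
Lemma commutant_upper_scalar a b c d e s w Y :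
  w != 0 -> [/\ b != 0 & e != 0] \/ [/\ a - c != 0 & a - d != 0] ->
  let N := mx4 [:: [:: c; 0; 0; 0]; [:: 0; c; 0; 0];
                   [:: 0; 0; a; b]; [:: 0; 0; e; d]] in
  commutator N Y = 0 ->
  commutator N (commutator (diag_mx (\row_j (s + w * charge F j))) Y) = 0 ->
  forall k, k != o2 -> Y o2 k = 0 /\ Y k o2 = 0.
Proof.
move=> w0 nz N NY NHY; have [E /= G] := commutator_charge w0 NY NHY.
have bc : b != 0 \/ a - c != 0 by case: nz => -[]; [left|right].
have ec : e != 0 \/ a - c != 0 by case: nz => -[]; [left|right].
have bd : b != 0 \/ a - d != 0 by case: nz => -[]; [left|right].
have ed : e != 0 \/ a - d != 0 by case: nz => -[]; [left|right].
elim/ord4_ind => // _; split.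
- apply: (mulf_cancel0 ec); [comb (E o3 o0) (G o3 o0) (2 : F) (1 : F)|].
  comb (E o2 o0) (G o2 o0) (2 : F) (1 : F).
- apply: (mulf_cancel0 bc); [comb (E o0 o3) (G o0 o3) (-2 : F) (1 : F)|].
  comb (E o0 o2) (G o0 o2) (-2 : F) (1 : F).
- apply: (mulf_cancel0 ec); [comb (E o3 o1) (G o3 o1) (1 : F) (1 : F)|].
  comb (E o2 o1) (G o2 o1) (1 : F) (1 : F).
- apply: (mulf_cancel0 bc); [comb (E o1 o3) (G o1 o3) (-1 : F) (1 : F)|].
  comb (E o1 o2) (G o1 o2) (-1 : F) (1 : F).
(* The order-zero equation reads [b * Y o3 o2 = e * Y o2 o3]. The two entries have opposite charge
   differences, so the order-one equation is the same up to a sign on one side, and both products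
   vanish. *)
- apply: (mulf_cancel0 ed); [comb (E o2 o2) (G o2 o2) (-2^-1 : F) (-2^-1 : F)|].
  comb (E o2 o3) (G o2 o3) (0 : F) (1 : F).
- apply: (mulf_cancel0 bd); [comb (E o2 o2) (G o2 o2) (2^-1 : F) (-2^-1 : F)|].
  comb (E o3 o2) (G o3 o2) (0 : F) (1 : F).
Qed.

(** Mirror image of [commutant_upper_scalar] under reversal of the basis: charges change sign, the
    isolated index 2 becomes 1, and its diagonal entry is now [d]. *)
Lemma commutant_lower_scalar a b c d e s w Y :
  w != 0 -> [/\ b != 0 & e != 0] \/ [/\ d - c != 0 & a - d != 0] ->
  let N := mx4 [:: [:: a; b; 0; 0]; [:: e; d; 0; 0];
                   [:: 0; 0; c; 0]; [:: 0; 0; 0; c]] in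
  commutator N Y = 0 ->
  commutator N (commutator (diag_mx (\row_j (s + w * charge F j))) Y) = 0 ->
  forall k, k != o1 -> Y o1 k = 0 /\ Y k o1 = 0.
Proof.
move=> w0 nz N NY NHY; have [E /= G] := commutator_charge w0 NY NHY.
have bc : b != 0 \/ d - c != 0 by case: nz => -[]; [left|right].
have ec : e != 0 \/ d - c != 0 by case: nz => -[]; [left|right].
have bd : b != 0 \/ a - d != 0 by case: nz => -[]; [left|right].
have ed : e != 0 \/ a - d != 0 by case: nz => -[]; [left|right].
elim/ord4_ind => // _; split.
- apply: (mulf_cancel0 bd); [comb (E o0 o0) (G o0 o0) (2^-1 : F) (-2^-1 : F)|].
  comb (E o1 o0) (G o1 o0) (0 : F) (1 : F).
- apply: (mulf_cancel0 ed); [comb (E o0 o0) (G o0 o0) (-2^-1 : F) (-2^-1 : F)|].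
  comb (E o0 o1) (G o0 o1) (0 : F) (1 : F).
- apply: (mulf_cancel0 bc); [comb (E o0 o2) (G o0 o2) (1 : F) (-1 : F)|].
  comb (E o1 o2) (G o1 o2) (1 : F) (-1 : F).
- apply: (mulf_cancel0 ec); [comb (E o2 o0) (G o2 o0) (-1 : F) (-1 : F)|].
  comb (E o2 o1) (G o2 o1) (-1 : F) (-1 : F).
- apply: (mulf_cancel0 bc); [comb (E o0 o3) (G o0 o3) (2 : F) (-1 : F)|].
  comb (E o1 o3) (G o1 o3) (2 : F) (-1 : F).
- apply: (mulf_cancel0 ec); [comb (E o3 o0) (G o3 o0) (-2 : F) (-1 : F)|].
  comb (E o3 o1) (G o3 o1) (-2 : F) (-1 : F).
Qed.

(* In the eigenbasis of the Hamiltonian the commutant is M_2 (x) 1, up to the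
   phase relating (b, e) to (b2, e2); the last hypothesis is invariance under the
   swap written in that basis, where it exchanges the two middle vectors up to
   sign. *)
Lemma commutant_doubled_swap a b d e b2 e2 s w Y :
  w != 0 -> b != 0 -> e != 0 -> b2 != 0 -> e2 != 0 ->
  let N := mx4 [:: [:: a; b; 0; 0]; [:: e; d; 0; 0];
                   [:: 0; 0; a; b2]; [:: 0; 0; e2; d]] in
  let S := mx4 [:: [:: 1; 0; 0; 0]; [:: 0; 0; -1; 0];
                   [:: 0; -1; 0; 0]; [:: 0; 0; 0; 1]] in
  commutator N Y = 0 ->
  commutator N (commutator (diag_mx (\row_j (s + w * charge F j))) Y) = 0 ->
  S *m Y = Y *m S -> Y = (Y o0 o0)%:M.
Proof.
move=> w0 b0 e0 b20 e20 N S NY NHY SY.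
have [E /= G] := commutator_charge w0 NY NHY.
have can x y : x != 0 -> y * x = 0 -> y = 0 :> F.
  by move=> n0 h; apply: (mulf_cancel0 _ h h); left.
have {}SY i j := etrans (esym (mulmx4E S Y i j))
  (etrans (congr1 (fun M : 'M[F]_4 => M i j) SY) (mulmx4E Y S i j)).
have y01 : Y o0 o1 = 0.
  by apply: (can _ _ e0); comb (E o0 o0) (G o0 o0) (-2^-1 : F) (-2^-1 : F).
have y10 : Y o1 o0 = 0.
  by apply: (can _ _ b0); comb (E o0 o0) (G o0 o0) (2^-1 : F) (-2^-1 : F).
have y23 : Y o2 o3 = 0.
  by apply: (can _ _ e20); comb (E o2 o2) (G o2 o2) (-2^-1 : F) (-2^-1 : F).
have y32 : Y o3 o2 = 0.
  by apply: (can _ _ b20); comb (E o2 o2) (G o2 o2) (2^-1 : F) (-2^-1 : F).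
(* In this entry of the order-one equation [Y o1 o2] has weight 0 and the terms in [Y o0 o2] cancel,
   leaving a multiple of [Y o0 o3 * e2]. *)
have y03 : Y o0 o3 = 0.
  by apply: (can _ _ e20); comb (G o0 o2) (G o0 o2) (-2^-1 : F) (0 : F).
have y30 : Y o3 o0 = 0.
  by apply: (can _ _ b20); comb (G o2 o0) (G o2 o0) (-2^-1 : F) (0 : F).
have y12 : Y o1 o2 = 0.
  apply: (can _ _ b0); have := E o0 o2; rewrite y03 => E02.
  by comb E02 E02 (1 : F) (0 : F).
have y21 : Y o2 o1 = 0.
  apply: (can _ _ e0); have := E o2 o0; rewrite y30 => E20.
  by comb E20 E20 (-1 : F) (0 : F).
(* Here SWAP invariance enters: it identifies this entry, up to sign, with [Y o0 o1]. Below it also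
   equates the diagonals of the two blocks. *)
have y02 : Y o0 o2 = 0.
  have := SY o0 o1; rewrite y01 => SY01.
  by comb SY01 SY01 (1 : F) (0 : F).
have y20 : Y o2 o0 = 0.
  have := SY o1 o0; rewrite y10 => SY10.
  by comb SY10 SY10 (-1 : F) (0 : F).
have y13 : Y o1 o3 = 0.
  apply: (can _ _ b0); have := E o0 o3; rewrite y03 y02 => E03.
  by comb E03 E03 (1 : F) (0 : F).
have y31 : Y o3 o1 = 0.
  apply: (can _ _ b20); have := E o2 o1; rewrite y20 y21 => E21.
  by comb E21 E21 (1 : F) (0 : F).
have y11 : Y o1 o1 = Y o0 o0.
  apply/subr0_eq; apply: (can _ _ b0); have := E o0 o1; rewrite y01 => E01.
  by comb E01 E01 (1 : F) (0 : F).
have y33 : Y o3 o3 = Y o2 o2.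
  apply/subr0_eq; apply: (can _ _ b20); have := E o2 o3; rewrite y23 => E23.
  by comb E23 E23 (1 : F) (0 : F).
have y22 : Y o2 o2 = Y o1 o1.
  by apply/subr0_eq; comb (SY o1 o2) (SY o1 o2) (-1 : F) (0 : F).
apply/matrixP; elim/ord4_ind; elim/ord4_ind; rewrite [RHS]mxE /= ?mulr1n ?mulr0n.
all: by rewrite // ?y33 ?y22 ?y11.
Qed.

End CommutantEntries.

(** * Unitary change of basis *)

Section UnitaryConjugation.
Context {R : rcfType} {n : nat}.
Local Notation C := R[i].
Implicit Types U N D X : 'M[C]_n.

Lemma normal_unitary_conj U N : adjmx U *m U = 1%:M ->
  adjmx N *m N = N *m adjmx N ->
  let L := U *m N *m adjmx U in adjmx L *m L = L *m adjmx L.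
Proof.
move=> U1 NN L.
have -> : adjmx L = U *m adjmx N *m adjmx U.
  by rewrite /L 2!adjmxM adjmxK mulmxA.
have prod A B : (U *m A *m adjmx U) *m (U *m B *m adjmx U)
    = U *m (A *m B) *m adjmx U.
  rewrite !mulmxA -(mulmxA _ (adjmx U) U) U1 mulmx1.
  by rewrite -(mulmxA U A B).
by rewrite /L !prod NN.
Qed.

(** As [U] commutes with [D], the matrix [D] is its own conjugate, so both equations keep their form
    with [L] replaced by the block matrix [N]. *)
Lemma commutator_unitary_conj U N D X : adjmx U *m U = 1%:M ->
  D *m U = U *m D ->
  let L := U *m N *m adjmx U in let Y := adjmx U *m X *m U in
  commutator L X = 0 -> commutator L (commutator D X) = 0 ->
  commutator N Y = 0 /\ commutator N (commutator D Y) = 0.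
Proof.
move=> U1 DU L Y LX LDX.
have U2 : U *m adjmx U = 1%:M by exact: mulmx1C.
have prod A B : (adjmx U *m A *m U) *m (adjmx U *m B *m U)
    = adjmx U *m (A *m B) *m U.
  rewrite !mulmxA -(mulmxA _ U (adjmx U)) U2 mulmx1.
  by rewrite -(mulmxA (adjmx U) A B).
have comm A B : commutator (adjmx U *m A *m U) (adjmx U *m B *m U)
    = adjmx U *m commutator A B *m U.
  by rewrite /commutator !prod mulmxBr mulmxBl.
have NE : N = adjmx U *m L *m U.
  by rewrite /L !mulmxA U1 mul1mx -mulmxA U1 mulmx1.
have DE : D = adjmx U *m D *m U by rewrite -mulmxA DU mulmxA U1 mul1mx.
split; first by rewrite NE comm LX mulmx0 mul0mx.
by rewrite NE [in X in commutator D X]/Y {1}DE !comm LDX mulmx0 mul0mx.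
Qed.

End UnitaryConjugation.

(** * Normality of the defining block matrices *)

Section NormalBlocks.
Context {F : fieldType}.
Implicit Types a b ac bc c m u v : F.

(** For a unit phase [u] and real [m] the block is [a] plus [u] times a Hermitian matrix, hence
    normal. Treating the conjugates [ac], [bc] as free variables and the conjugate of [u] as [u^-1]
    turns this into rational identities. *)
Lemma upper_scalar_normal a b ac bc c m u : u != 0 ->
  let N := mx4 [:: [:: c; 0; 0; 0]; [:: 0; c; 0; 0];
                   [:: 0; 0; a; b]; [:: 0; 0; u ^+ 2 * bc; a + m * u]] in
  let M := mx4 [:: [:: c; 0; 0; 0]; [:: 0; c; 0; 0];
                   [:: 0; 0; ac; u ^- 2 * b]; [:: 0; 0; bc; ac + m * u^-1]] in
  M *m N = N *m M.
Proof.
move=> u0; apply/matrixP; elim/ord4_ind; elim/ord4_ind;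
  rewrite !mulmx4E !mx4E /=; by field.
Qed.

Lemma lower_scalar_normal a b ac bc c m u : u != 0 ->
  let N := mx4 [:: [:: a; b; 0; 0]; [:: u ^+ 2 * bc; a + m * u; 0; 0];
                   [:: 0; 0; c; 0]; [:: 0; 0; 0; c]] in
  let M := mx4 [:: [:: ac; u ^- 2 * b; 0; 0]; [:: bc; ac + m * u^-1; 0; 0];
                   [:: 0; 0; c; 0]; [:: 0; 0; 0; c]] in
  M *m N = N *m M.
Proof.
move=> u0; apply/matrixP; elim/ord4_ind; elim/ord4_ind;
  rewrite !mulmx4E !mx4E /=; by field.
Qed.

(** The second block is the first one conjugated by the diagonal matrix with entries 1 and [v]. *)
Lemma doubled_normal a b ac bc m u v : u != 0 -> v != 0 ->
  let N := mx4 [:: [:: a; b; 0; 0]; [:: u ^+ 2 * bc; a + m * u; 0; 0];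
                   [:: 0; 0; a; v^-1 * b];
                   [:: 0; 0; v * u ^+ 2 * bc; a + m * u]] in
  let M := mx4 [:: [:: ac; u ^- 2 * b; 0; 0]; [:: bc; ac + m * u^-1; 0; 0];
                   [:: 0; 0; ac; v^-1 * u ^- 2 * b];
                   [:: 0; 0; v * bc; ac + m * u^-1]] in
  M *m N = N *m M.
Proof.
move=> u0 v0; apply/matrixP; elim/ord4_ind; elim/ord4_ind;
  rewrite !mulmx4E !mx4E /=; field; by rewrite ?u0 ?v0.
Qed.

End NormalBlocks.

(** * Unit complex phases *)

Section Phases.
Context {R : realType}.
Local Notation C := R[i].

Lemma expi0 : expi (0 : R) = 1.
Proof. by rewrite /expi cos0 sin0. Qed.

Lemma expiD (x y : R) : expi (x + y) = expi x * expi y.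
Proof.
rewrite /expi cosD sinD; apply/eqP; rewrite eq_complex /=.
by apply/andP; split; apply/eqP; ring.
Qed.

Lemma expi_neq0 (x : R) : expi x != 0.
Proof.
apply/eqP => h; have := expiD x (- x).
by rewrite h mul0r subrr expi0 => /eqP; rewrite oner_eq0.
Qed.

Lemma expiN (x : R) : expi (- x) = (expi x)^-1.
Proof.
apply: (mulfI (expi_neq0 x)).
by rewrite -expiD subrr expi0 mulfV ?expi_neq0.
Qed.

Lemma expi2 (x : R) : expi (2 * x) = expi x ^+ 2.
Proof. by rewrite mulr_natl mulr2n expiD. Qed.

Lemma conjc_expi (x : R) : conjc (expi x) = (expi x)^-1.
Proof. by rewrite -expiN /expi cosN sinN. Qed.

End Phases.

(** * Matrices acting on the middle level only *)

Section MiddleBlock.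

(** The span of |01> and |10> is the degenerate level of the Hamiltonian. SWAP and, at phase zero,
    [T1], [T2] and [Ttheta] all have this form, so they commute with the Hamiltonian. *)
Definition midmx (K : nzRingType) (x y z t : K) : 'M[K]_4 :=
  mx4 [:: [:: 1; 0; 0; 0]; [:: 0; x; y; 0]; [:: 0; z; t; 0]; [:: 0; 0; 0; 1]].

Lemma midmx1 (K : nzRingType) : midmx 1 0 0 1 = 1%:M :> 'M[K]_4.
Proof.
by apply/matrixP; elim/ord4_ind; elim/ord4_ind; rewrite mx4E mxE.
Qed.

Lemma midmxM (K : nzRingType) (x y z t x' y' z' t' : K) :
  midmx x y z t *m midmx x' y' z' t'
  = midmx (x * x' + y * z') (x * y' + y * t')
          (z * x' + t * z') (z * y' + t * t').
Proof.
apply/matrixP; elim/ord4_ind; elim/ord4_ind; rewrite mulmx4E !mx4E /=.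
all: by rewrite ?(mulr0, mul0r, mulr1, addr0, add0r).
Qed.

Lemma adjmx_midmx (R : rcfType) (x y z t : R[i]) :
  adjmx (midmx x y z t) = midmx (conjc x) (conjc z) (conjc y) (conjc t).
Proof.
apply/matrixP; elim/ord4_ind; elim/ord4_ind; rewrite adjmxE !mx4E /=.
all: by rewrite ?oppr0.
Qed.

Lemma midmx_charge (F : numFieldType) (s w x y z t : F) :
  diag_mx (\row_j (s + w * charge F j)) *m midmx x y z t
  = midmx x y z t *m diag_mx (\row_j (s + w * charge F j)).
Proof.
rewrite mul_diag_mx mul_mx_diag; apply/matrixP; elim/ord4_ind; elim/ord4_ind;
  rewrite [LHS]mxE [RHS]mxE !mx4E !mxE /charge /=; ring.
Qed.

(** At phase zero, index 2 of the basis [T1] is the antisymmetric vector, and SWAP becomes the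
    reflection negating it. In the basis [T2] this vector has index 1, whence the companion
    lemma. *)
Lemma midmx_sign2_comm (K : comNzRingType) (Y : 'M[K]_4) :
  (forall k, k != o2 ->
     Y o2 k = 0 /\ Y k o2 = 0) ->
  midmx 1 0 0 (-1) *m Y = Y *m midmx 1 0 0 (-1).
Proof.
move=> Y2; have [y20 y02] := Y2 o0 isT.
have [y21 y12] := Y2 o1 isT.
have [y23 y32] := Y2 o3 isT.
apply/matrixP; elim/ord4_ind; elim/ord4_ind; rewrite !mulmx4E !mx4E /=
  ?(y20, y02, y21, y12, y23, y32); ring.
Qed.

Lemma midmx_sign1_comm (K : comNzRingType) (Y : 'M[K]_4) :
  (forall k, k != o1 ->
     Y o1 k = 0 /\ Y k o1 = 0) ->
  midmx (-1) 0 0 1 *m Y = Y *m midmx (-1) 0 0 1.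
Proof.
move=> Y1; have [y10 y01] := Y1 o0 isT.
have [y12 y21] := Y1 o2 isT.
have [y13 y31] := Y1 o3 isT.
apply/matrixP; elim/ord4_ind; elim/ord4_ind; rewrite !mulmx4E !mx4E /=
  ?(y10, y01, y12, y21, y13, y31); ring.
Qed.

End MiddleBlock.

(** * The three classes: normality and commutants *)

Section PermutationInvariance.
Context {R : realType}.
Local Notation C := R[i].

Lemma swap_midmx : swap = midmx 0 1 1 0 :> 'M[C]_4.
Proof. exact: swapE. Qed.

Lemma swapK : swap *m swap = 1%:M :> 'M[C]_4.
Proof.
by rewrite swap_midmx midmxM !mulr0 !mul0r !mulr1 !addr0 !add0r midmx1.
Qed.

Lemma perm_invariantP (X : 'M[C]_4) :
  perm_invariant X <-> swap *m X = X *m swap.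
Proof.
rewrite /perm_invariant; split=> [{2}<-|->]; last first.
  by rewrite -mulmxA swapK mulmx1.
by rewrite -[RHS]mulmxA swapK mulmx1.
Qed.

Lemma perm_invariant_conj (U S X : 'M[C]_4) : adjmx U *m U = 1%:M ->
  swap *m U = U *m S -> let Y := adjmx U *m X *m U in
  perm_invariant X <-> S *m Y = Y *m S.
Proof.
move=> U1 SU Y.
have U2 : U *m adjmx U = 1%:M by exact: mulmx1C.
have SE : S = adjmx U *m swap *m U by rewrite -mulmxA SU mulmxA U1 mul1mx.
have inj (A B : 'M[C]_4) : adjmx U *m A *m U = adjmx U *m B *m U -> A = B.
  move=> /(congr1 (fun Z => U *m Z *m adjmx U)).
  by rewrite !mulmxA U2 !mul1mx -!mulmxA U2 !mulmx1.
have prod (A B : 'M[C]_4) : (adjmx U *m A *m U) *m (adjmx U *m B *m U)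
    = adjmx U *m (A *m B) *m U.
  rewrite !mulmxA -(mulmxA _ U (adjmx U)) U2 mulmx1.
  by rewrite -(mulmxA (adjmx U) A B).
rewrite perm_invariantP SE !prod; split=> [->//|]; exact: inj.
Qed.

Lemma T1_midmx : T1 (0 : R) =
  let r := ((Num.sqrt 2)^-1)%:C in midmx r r r (- r).
Proof. by rewrite /T1 expi0 !mul1r. Qed.

Lemma T2_midmx : T2 (0 : R) =
  let r := ((Num.sqrt 2)^-1)%:C in midmx r r (- r) r.
Proof. by rewrite /T2 expi0 !mul1r. Qed.

Lemma Ttheta_midmx (theta : R) : Ttheta theta 0 =
  let q := 'i * (sin theta)%:C in let p := (cos theta)%:C in
  midmx q p (- p) (- q).
Proof. by rewrite /Ttheta oppr0 expi0 !mulr1. Qed.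

Lemma rsqrt2M : ((Num.sqrt 2 : R)^-1)%:C * ((Num.sqrt 2 : R)^-1)%:C = 2^-1 :> C.
Proof.
rewrite -rmorphM -invfM -expr2 sqr_sqrtr ?ler0n //.
by rewrite fmorphV rmorph_nat.
Qed.

Lemma conjc_oppr (x : R) : conjc (- x%:C) = - x%:C.
Proof. by rewrite -rmorphN conjc_real. Qed.

Lemma T1_unitary : adjmx (T1 (0 : R)) *m T1 0 = 1%:M.
Proof.
rewrite T1_midmx /= adjmx_midmx midmxM conjc_oppr conjc_real.
rewrite !mulrN !mulNr opprK rsqrt2M subrr.
by rewrite half_half midmx1.
Qed.

Lemma T2_unitary : adjmx (T2 (0 : R)) *m T2 0 = 1%:M.
Proof.
rewrite T2_midmx /= adjmx_midmx midmxM conjc_oppr conjc_real.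
rewrite !mulrN !mulNr opprK rsqrt2M subrr.
by rewrite half_half midmx1.
Qed.

Lemma Ttheta_unitary (theta : R) :
  adjmx (Ttheta theta 0) *m Ttheta theta 0 = 1%:M.
Proof.
rewrite Ttheta_midmx /= adjmx_midmx midmxM.
have -> : conjc ('i * (sin theta)%:C) = - ('i * (sin theta)%:C) by simpc.
have -> : conjc (- ('i * (sin theta)%:C)) = 'i * (sin theta)%:C by simpc.
rewrite conjc_oppr conjc_real.
set q := 'i * _; set p := _%:C.
have pq : p * p - q * q = 1.
  rewrite /q mulrACA -(expr2 'i) sqr_i mulN1r opprK -!rmorphM -rmorphD /=.
  by rewrite -!expr2 cos2Dsin2.
by rewrite -midmx1; congr midmx; rewrite -?pq; ring.
Qed.

Lemma conjc_phase (k : R) (b : C) :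
  conjc (expi k ^+ 2 * conjc b) = expi k ^- 2 * b.
Proof.
rewrite rmorphM rmorphXn -exprVn; congr (_ ^+ 2 * _); first exact: conjc_expi.
exact: conjcK.
Qed.

Lemma conjc_diag (k m : R) (a : C) :
  conjc (a + m%:C * expi k) = conjc a + m%:C * (expi k)^-1.
Proof.
rewrite rmorphD rmorphM; congr (_ + _ * _); first exact: conjc_real.
exact: conjc_expi.
Qed.

Ltac adjoint_entries := apply/matrixP; elim/ord4_ind; elim/ord4_ind;
  rewrite adjmxE !mx4E; cbn [nth nat_of_ord];
  rewrite ?conjc0 ?conjc_real ?conjc_phase ?conjc_diag.

Lemma class1_normal (L : 'M[C]_4) : class1 0 L -> adjmx L *m L = L *m adjmx L.
Proof.
move=> [a [b [c [k [m [_ ->]]]]]].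
apply: normal_unitary_conj T1_unitary _; rewrite expi2.
set N := mx4 _.
suff -> : adjmx N = mx4 [:: [:: c%:C; 0; 0; 0]; [:: 0; c%:C; 0; 0];
   [:: 0; 0; conjc a; expi k ^- 2 * b];
   [:: 0; 0; conjc b; conjc a + m%:C * (expi k)^-1]].
  exact: upper_scalar_normal (expi_neq0 k).
by adjoint_entries.
Qed.

Lemma class2_normal (L : 'M[C]_4) : class2 0 L -> adjmx L *m L = L *m adjmx L.
Proof.
move=> [a [b [c [k [m [_ ->]]]]]].
apply: normal_unitary_conj T2_unitary _; rewrite expi2.
set N := mx4 _.
suff -> : adjmx N = mx4 [:: [:: conjc a; expi k ^- 2 * b; 0; 0];
   [:: conjc b; conjc a + m%:C * (expi k)^-1; 0; 0];
   [:: 0; 0; c%:C; 0]; [:: 0; 0; 0; c%:C]].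
  exact: lower_scalar_normal (expi_neq0 k).
by adjoint_entries.
Qed.

Lemma class_theta_normal (theta : R) (L : 'M[C]_4) :
  class_theta theta 0 L -> adjmx L *m L = L *m adjmx L.
Proof.
move=> [a [b [k [m [_ ->]]]]].
apply: normal_unitary_conj (Ttheta_unitary theta) _.
rewrite (expi2 k) expiN; set v := expi (2 * theta); set N := mx4 _.
have cv : conjc v = v^-1 by exact: conjc_expi.
suff -> : adjmx N = mx4 [:: [:: conjc a; expi k ^- 2 * b; 0; 0];
   [:: conjc b; conjc a + m%:C * (expi k)^-1; 0; 0];
   [:: 0; 0; conjc a; v^-1 * expi k ^- 2 * b];
   [:: 0; 0; v * conjc b; conjc a + m%:C * (expi k)^-1]].
  exact: doubled_normal (expi_neq0 k) (expi_neq0 _).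
adjoint_entries => //.
  rewrite -mulrA -[RHS]mulrA rmorphM; congr (_ * _).
    exact: cv.
  exact: conjc_phase.
rewrite rmorphM; congr (_ * _); apply: etrans (conjc_inv _) _.
by rewrite cv invrK.
Qed.

Section Commutants.
Variables E0 E1 : R.
Hypothesis E01 : E0 - E1 != 0.
Let H := hamiltonian E0 E1.

Let E01C : (E0 - E1)%:C != 0 :> C.
Proof. by rewrite fmorph_eq0. Qed.

Let HU x y z t : H *m midmx x y z t = midmx x y z t *m H.
Proof. by rewrite /H hamiltonianE midmx_charge. Qed.

Lemma class1_commutant (L X : 'M[C]_4) : class1 0 L ->
  commutator L X = 0 -> commutator L (commutator H X) = 0 -> perm_invariant X.
Proof.
move=> [a [b [c [k [m [nz ->]]]]]] LX LHX.
have HT : H *m T1 0 = T1 0 *m H by rewrite T1_midmx; exact: HU.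
have [NY NHY] := commutator_unitary_conj T1_unitary HT LX LHX.
have ST : swap *m T1 (0 : R) = T1 0 *m midmx 1 0 0 (-1).
  rewrite T1_midmx swap_midmx !midmxM.
  by rewrite !mulr0 !mul0r !mul1r !mulr1 !mulrN1 !addr0 !add0r ?opprK.
apply/(perm_invariant_conj _ T1_unitary ST).
move: NY NHY; set Y := adjmx _ *m X *m _; rewrite {1}/H hamiltonianE.
move=> NY /(commutant_upper_scalar E01C _ NY) Y2.
apply: midmx_sign2_comm; apply: Y2.
case: nz => [b0|[ac m0]]; [left | right]; split=> //.
- by rewrite mulf_neq0 ?expi_neq0 // conjc_eq0.
- by rewrite subr_eq0.
- by rewrite opprD addNKr oppr_eq0 mulf_neq0 ?expi_neq0 // fmorph_eq0.
Qed.

Lemma class2_commutant (L X : 'M[C]_4) : class2 0 L ->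
  commutator L X = 0 -> commutator L (commutator H X) = 0 -> perm_invariant X.
Proof.
move=> [a [b [c [k [m [nz ->]]]]]] LX LHX.
have HT : H *m T2 0 = T2 0 *m H by rewrite T2_midmx; exact: HU.
have [NY NHY] := commutator_unitary_conj T2_unitary HT LX LHX.
have ST : swap *m T2 (0 : R) = T2 0 *m midmx (-1) 0 0 1.
  rewrite T2_midmx swap_midmx !midmxM.
  by rewrite !mulr0 !mul0r !mul1r !mulr1 !mulrN1 !addr0 !add0r ?opprK.
apply/(perm_invariant_conj _ T2_unitary ST).
move: NY NHY; set Y := adjmx _ *m X *m _; rewrite {1}/H hamiltonianE.
move=> NY /(commutant_lower_scalar E01C _ NY) Y1.
apply: midmx_sign1_comm; apply: Y1.
case: nz => [b0|[ac m0]]; [left | right]; split=> //.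
- by rewrite mulf_neq0 ?expi_neq0 // conjc_eq0.
- by rewrite subr_eq0.
- by rewrite opprD addNKr oppr_eq0 mulf_neq0 ?expi_neq0 // fmorph_eq0.
Qed.

Lemma class_theta_commutant (theta : R) (L X : 'M[C]_4) :
  class_theta theta 0 L ->
  commutator L X = 0 -> commutator L (commutator H X) = 0 -> perm_invariant X ->
  exists c : C, X = c%:M.
Proof.
move=> [a [b [k [m [b0 ->]]]]] LX LHX.
have TT := Ttheta_unitary theta; set T := Ttheta theta 0 in TT LX LHX *.
have HT : H *m T = T *m H by rewrite /T Ttheta_midmx; exact: HU.
have [NY NHY] := commutator_unitary_conj TT HT LX LHX.
(* The middle columns of [T] are (q, -p) and (p, -q), so exchanging coordinates maps each to minus
   the other. *)
have ST : swap *m T = T *m midmx 0 (-1) (-1) 0.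
  rewrite /T Ttheta_midmx swap_midmx !midmxM.
  by rewrite !mulr0 !mul0r !mul1r !mulrN1 !addr0 !add0r ?opprK.
move=> /(perm_invariant_conj _ TT ST); move: NY NHY.
set Y := adjmx _ *m X *m _; rewrite {1}/H hamiltonianE.
move=> NY /(commutant_doubled_swap E01C _ _ _ _ NY) YE SY.
have bc0 : conjc b != 0 by rewrite conjc_eq0.
exists (Y o0 o0).
have {}YE := YE b0 _ _ _ SY.
have TT' : T *m adjmx T = 1%:M by exact: mulmx1C.
have -> : X = T *m Y *m adjmx T.
  by rewrite /Y !mulmxA TT' mul1mx -mulmxA TT' mulmx1.
rewrite {1}YE ?mulf_neq0 ?expi_neq0 //.
by rewrite mul_mx_scalar -scalemxAl TT' scalemx1.
Qed.

End Commutants.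

End PermutationInvariance.

(** * A Barbalat lemma for dissipated quantities *)

Section Barbalat.
Context {R : realType}.

Lemma MVT_positive (f df : R -> R) (a b : R) : 0 < a -> a < b ->
  (forall t : R, 0 < t -> is_derive t 1 f (df t)) ->
  exists2 c, a < c < b & f b - f a = df c * (b - a).
Proof.
move=> a0 ab fdf.
have [||c] := @MVT R f df a b ab.
- by move=> x; rewrite in_itv /= => /andP[ax _]; apply: fdf; exact: lt_trans ax.
- apply: derivable_within_continuous => x; rewrite in_itv /= => /andP[ax _].
  by have := fdf x (lt_le_trans a0 ax); case.
by rewrite in_itv /=; exists c.
Qed.

Lemma derive_le0_antitone (V D : R -> R) (s t : R) :
  (forall u : R, 0 < u -> is_derive u 1 V (- D u)) -> (forall u, 0 <= D u) ->
  0 < s -> s <= t -> V t <= V s.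
Proof.
move=> dV D0 s0; rewrite le_eqVlt => /predU1P[->//|st].
have [c _ Vc] := MVT_positive s0 st dV.
by rewrite -subr_le0 Vc mulNr oppr_le0 mulr_ge0 // subr_ge0 ltW.
Qed.

(** One-sided Barbalat argument: [V] decreases and is bounded below, so late time windows dissipate
    little; as [D] cannot fall fast, a large value of [D] would persist and dissipate too much. *)
Lemma dissipation_cvg0 (V D dD : R -> R) (M : R) :
  (forall t : R, 0 < t -> is_derive t 1 V (- D t)) ->
  (forall t : R, 0 < t -> is_derive t 1 D (dD t)) ->
  (forall t : R, 0 <= V t) -> (forall t, 0 <= D t) ->
  (forall t : R, 1 <= t -> - M <= dD t) ->
  D t @[t --> +oo] --> (0 : R).
Proof.
move=> dV ddD V0 D0 dDM; apply/cvgr0Pnorm_lt => e e0.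
pose N := Num.max M 0 + 1.
have N0 : 0 < N by rewrite ltr_wpDl // le_max lexx orbT.
have MN : M <= N by rewrite ler_wpDr // le_max lexx.
(* Window length over which [D] can fall by at most [N * h = e / 2]. *)
pose h := e / 2 / N.
have h0 : 0 < h by rewrite !divr_gt0.
pose S := [set V t | t in [set t | 1 <= t]].
have S_lb : has_lbound S by exists 0 => _ [t _ <-]; exact: V0.
have S_inf : has_inf S by split=> //; exists (V 1), 1 => //=.
have he0 : 0 < h * (e / 2) by rewrite mulr_gt0 ?divr_gt0.
(* After [t0] less than [h * (e / 2)] remains to be dissipated. *)
have [_ [t0 t01 <-] Vt0] := inf_adherent he0 S_inf.
near=> t.
have t0t : t0 <= t by near: t; apply: nbhs_pinfty_ge; rewrite num_real.
have t1 : 1 <= t by exact: le_trans t01 t0t.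
have tp : 0 < t by exact: lt_le_trans t1.
have tth : t < t + h by rewrite ltrDl.
(* [D c] is the mean dissipation over the window, below [e / 2]; returning from [c] to [t] raises
   [D] by at most [e / 2]. *)
have [c /andP[tc cth] Vc] := MVT_positive tp tth dV.
have [x /andP[tx xc] Dx] := MVT_positive tp tc ddD.
have Vth : inf S <= V (t + h).
  by apply: ge_inf => //; exists (t + h) => //=; exact: le_trans t1 (ltW tth).
have Vt : V t <= V t0.
  by apply: derive_le0_antitone dV D0 _ t0t; exact: lt_le_trans t01.
have Dc : D c < e / 2.
  rewrite -(ltr_pM2r h0); apply: (@le_lt_trans _ _ (V t - V (t + h))).
    by move: Vc; rewrite addrAC subrr add0r => Vc; lra.
  lra.
have Nh : N * h = e / 2 by rewrite /h; field; rewrite gt_eqF.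
have xM : - M <= dD x by apply: dDM; exact: le_trans t1 (ltW tx).
have Dt : D t <= D c + N * h.
  have : - N * (c - t) <= dD x * (c - t).
    by rewrite ler_pM2r ?subr_gt0 // (le_trans _ xM) // lerN2.
  have : N * (c - t) <= N * h by rewrite ler_pM2l //; lra.
  lra.
rewrite ger0_norm //; lra.
Unshelve. all: by end_near.
Qed.

End Barbalat.

(** * Derivatives of matrix-valued functions *)

Section MatrixDerivative.
Context {R : realType}.
Local Notation C := R[i].

Definition is_mxderive m n (t : R) (f : R -> 'M[C]_(m, n)) (df : 'M[C]_(m, n)) :=
  forall i j,
    is_derive t 1 (fun u => complex.Re (f u i j)) (complex.Re (df i j)) /\
    is_derive t 1 (fun u => complex.Im (f u i j)) (complex.Im (df i j)).

Lemma is_derive_bigsum n (t : R) (h : 'I_n -> R -> R) (dh : 'I_n -> R) :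
  (forall i, is_derive t 1 (h i) (dh i)) ->
  is_derive t 1 (fun u => \sum_i h i u) (\sum_i dh i).
Proof.
move=> hdh; rewrite (_ : (fun u => _) = \sum_i h i); first exact: is_derive_sum.
by apply/funext => u; rewrite fct_sumE.
Qed.

Lemma is_derive_mul (t : R) (f g : R -> R) (df dg : R) :
  is_derive t 1 f df -> is_derive t 1 g dg ->
  is_derive t 1 (fun u => f u * g u) (df * g t + f t * dg).
Proof.
move=> hf hg; apply: (is_derive_eq (is_deriveM hf hg)).
by rewrite addrC [g t *: df]mulrC.
Qed.

Lemma is_derive_rdot m n (t : R) (f g : R -> 'M[C]_(m, n)) df dg :
  is_mxderive t f df -> is_mxderive t g dg ->
  is_derive t 1 (fun u => rdot (f u) (g u)) (rdot df (g t) + rdot (f t) dg).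
Proof.
move=> hf hg; rewrite (funext (fun u => rdotE (f u) (g u))) !rdotE -big_split.
apply: is_derive_bigsum => j; rewrite -big_split.
apply: is_derive_bigsum => i; rewrite /= addrACA.
have [fR fI] := hf i j; have [gR gI] := hg i j.
by apply: is_deriveD; exact: is_derive_mul.
Qed.

(** Complex coefficients mix real and imaginary parts, so each entry of [F X] is expanded over
    matrix units into a real combination of the parts of the entries of [X]. *)
Lemma is_mxderive_linear m n p q (t : R) (f : R -> 'M[C]_(m, n)) df
    (F : {linear 'M[C]_(m, n) -> 'M[C]_(p, q)}) :
  is_mxderive t f df -> is_mxderive t (F \o f) (F df).
Proof.
move=> hf i j.
have FE X : F X i j = \sum_k \sum_l X k l * F (delta_mx k l) i j.
  rewrite {1}[X]matrix_sum_delta linear_sum summxE; apply: eq_bigr => k _.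
  rewrite linear_sum summxE; apply: eq_bigr => l _.
  by rewrite linearZ mxE.
have ReS (I : finType) (h : I -> C) :
    complex.Re (\sum_i h i) = \sum_i complex.Re (h i).
  by apply: (big_morph (@complex.Re R)) => // -[? ?] [? ?].
have ImS (I : finType) (h : I -> C) :
    complex.Im (\sum_i h i) = \sum_i complex.Im (h i).
  by apply: (big_morph (@complex.Im R)) => // -[? ?] [? ?].
have ReM (x y : C) : complex.Re (x * y)
    = complex.Re x * complex.Re y - complex.Im x * complex.Im y.
  by case: x y => ? ? [? ?].
have ImM (x y : C) : complex.Im (x * y)
    = complex.Re x * complex.Im y + complex.Im x * complex.Re y.
  by case: x y => ? ? [? ?].
have cst (h : R -> R) (dh c : R) : is_derive t 1 h dh ->
    is_derive t 1 (fun u => h u * c) (dh * c).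
  move=> hh; apply: (is_derive_eq (is_derive_mul hh (is_derive_cst c t 1))).
  by rewrite mulr0 addr0.
split.
  rewrite (_ : (fun u => _) = fun u => \sum_k \sum_l
      complex.Re (f u k l * F (delta_mx k l) i j)); last first.
    by apply/funext => u /=; rewrite FE ReS; apply: eq_bigr => k _; rewrite ReS.
  rewrite FE ReS; apply: is_derive_bigsum => k; rewrite ReS.
  apply: is_derive_bigsum => l; have [hR hI] := hf k l.
  rewrite ReM (funext (fun u => ReM (f u k l) _)).
  by apply: is_deriveB; exact: cst.
rewrite (_ : (fun u => _) = fun u => \sum_k \sum_l
    complex.Im (f u k l * F (delta_mx k l) i j)); last first.
  by apply/funext => u /=; rewrite FE ImS; apply: eq_bigr => k _; rewrite ImS.
rewrite FE ImS; apply: is_derive_bigsum => k; rewrite ImS.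
apply: is_derive_bigsum => l; have [hR hI] := hf k l.
rewrite ImM (funext (fun u => ImM (f u k l) _)).
by apply: is_deriveD; exact: cst.
Qed.

End MatrixDerivative.

(** * Factorization through a linear map, and decay along solutions *)

Lemma kernel_factorization (K : fieldType) (U V W : vectType K)
    (F : {linear U -> V}) (G : {linear U -> W}) :
  (forall x, F x = 0 -> G x = 0) ->
  exists k : {linear V -> W}, forall x, G x = k (F x).
Proof.
(* Here [(linfun F)^-1] is a generalized inverse: applied to [F x] it returns [x] up to an element
   of the kernel of [F], which [G] kills. *)
move=> FG; pose k := (linfun G \o (linfun F)^-1)%VF.
have kE y : k y = G ((linfun F)^-1%VF y) by rewrite comp_lfunE lfunE.
have FK x : F ((linfun F)^-1%VF (F x)) = F x.
  have := @limg_lfunVK _ _ _ (linfun F) (F x); rewrite lfunE; apply.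
  by rewrite -[F x](lfunE F) memv_img ?memvf.
exists k => x; apply: etrans (esym (kE (F x))).
by apply/subr0_eq; rewrite -linearB; apply: FG; rewrite linearB FK subrr.
Qed.

Section Decay.
Context {R : realType}.
Local Notation C := R[i].

Lemma rdot_ge m n (A B : 'M[C]_(m, n)) :
  - (rdot A A + rdot B B) <= rdot B A + rdot A B.
Proof.
have := rdot_ge0 (A + B); rewrite rdotDl !rdotDr.
by move: (rdot A A) (rdot A B) (rdot B A) (rdot B B) => u v w x; lra.
Qed.

Lemma rdot_col_mx m1 m2 n (A : 'M[C]_(m1, n)) (B : 'M[C]_(m2, n)) :
  rdot (col_mx A B) (col_mx A B) = rdot A A + rdot B B.
Proof.
rewrite /rdot /adjmx tr_col_mx map_row_mx mul_row_col mxtraceD.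
by case: (\tr _) (\tr _) => ? ? [? ?].
Qed.

Lemma linear_rdot_cvg0 m n p q (F : {linear 'M[C]_(m, n) -> 'M[C]_(p, q)})
    (f : R -> 'M[C]_(m, n)) :
  rdot (f t) (f t) @[t --> +oo] --> (0 : R) ->
  rdot (F (f t)) (F (f t)) @[t --> +oo] --> (0 : R).
Proof.
move=> f0; have [K K0 FK] := rdot_linear_bound F.
apply: (@squeeze_cvgr _ _ _ _ (fun=> 0) (fun t => K * rdot (f t) (f t))).
- by near=> t; rewrite rdot_ge0 FK.
- exact: cvg_cst.
- by rewrite -(mulr0 K); apply: cvgM => //; exact: cvg_cst.
Unshelve. all: by end_near.
Qed.

Lemma rdot_cvg0_normc m n (f : R -> 'M[C]_(m, n)) i j :
  rdot (f t) (f t) @[t --> +oo] --> (0 : R) ->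
  Normc.normc (f t i j) @[t --> +oo] --> (0 : R).
Proof.
move=> /cvgr0Pnorm_lt f0; apply/cvgr0Pnorm_lt => e e0.
have n0 (z : C) : 0 <= Normc.normc z by case: z => a b; exact: sqrtr_ge0.
have := f0 _ (exprn_gt0 2 e0); apply: filterS => t.
rewrite !ger0_norm ?rdot_ge0 // => fe.
by rewrite -(ltr_pXn2r (n := 2)) ?nnegrE ?n0 ?ltW //
           (le_lt_trans _ fe) ?normc_le_rdot.
Qed.

Variables H L : 'M[C]_4.
Hypothesis hermH : adjmx H = H.
Hypothesis normL : adjmx L *m L = L *m adjmx L.

Definition solution (f : R -> 'M[C]_4) :=
  forall t : R, 0 < t -> is_mxderive t f (lindbladian H L (f t)).

(** The equation is linear and autonomous, so its right-hand side is again a solution. *)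
Lemma solution_lindbladian f : solution f -> solution (lindbladian H L \o f).
Proof. by move=> hf t t0; apply: is_mxderive_linear; exact: hf. Qed.

Lemma solution_commutator_cvg0 f : solution f ->
  rdot (commutator L (f t)) (commutator L (f t)) @[t --> +oo] --> (0 : R).
Proof.
move=> hf; pose CL : {linear 'M[C]_4 -> 'M[C]_4} := commutator L.
pose LL : {linear 'M[C]_4 -> 'M[C]_4} := lindbladian H L.
have [K K0 CK] := rdot_linear_bound CL.
have [K' K'0 CK'] := rdot_linear_bound (CL \o LL).
pose V t := rdot (f t) (f t).
pose D t := rdot (CL (f t)) (CL (f t)).
have D0 t : 0 <= D t by exact: rdot_ge0.
have dV (t : R) : 0 < t -> is_derive t 1 V (- D t).
  move=> t0; apply: (is_derive_eq (is_derive_rdot (hf t t0) (hf t t0))).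
  have := rdot_lindbladian hermH normL (f t).
  rewrite [X in X + _]rdotC /D /=; move: (rdot _ _) (rdot _ _) => u v; lra.
pose dD t := rdot (CL (LL (f t))) (CL (f t)) + rdot (CL (f t)) (CL (LL (f t))).
have ddD (t : R) : 0 < t -> is_derive t 1 D (dD t).
  move=> t0; apply: is_derive_rdot; exact: (is_mxderive_linear CL (hf t t0)).
(* By [rdot_ge], [dD t] is at least minus the squared norms of [CL (f t)] and [CL (LL (f t))]; these
   are at most [K * V t] and [K' * V t], and [V t <= V 1]. *)
apply: (@dissipation_cvg0 _ V D dD ((K + K') * V 1)) => //.
  by move=> t; exact: rdot_ge0.
move=> t t1; apply: le_trans (rdot_ge _ _); rewrite lerN2.
have Vt : V t <= V 1 by exact: derive_le0_antitone dV D0 _ t1.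
rewrite mulrDl; apply: lerD.
  by apply: le_trans (CK _) _; rewrite ler_wpM2l.
by apply: le_trans (CK' (f t)) _; rewrite ler_wpM2l.
Qed.

(** Stacking makes the common kernel of the two maps the kernel of one map, and the squared norms
    add. *)
Definition dissipation_map (X : 'M[C]_4) : 'M[C]_(4 + 4, 4) :=
  col_mx (commutator L X) (commutator L (lindbladian H L X)).

Lemma dissipation_map_is_linear : linear dissipation_map.
Proof.
move=> a X Y; rewrite /dissipation_map (linearP (lindbladian H L)).
by rewrite !(linearP (commutator L)) scale_col_mx add_col_mx.
Qed.

HB.instance Definition _ :=
  GRing.isLinear.Build C 'M[C]_4 'M[C]_(4 + 4, 4) *:%R dissipation_map
    dissipation_map_is_linear.

(** The kernel of [dissipation_map] lies in the kernel of [G] by [commutator_lindbladian_eq0], so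
    [G] is a bounded linear map applied to [dissipation_map (f t)], which decays. *)
Lemma solution_linear_cvg0 p q (G : {linear 'M[C]_4 -> 'M[C]_(p, q)}) f i j :
  (forall X, commutator L X = 0 -> commutator L (commutator H X) = 0 ->
     G X = 0) ->
  solution f ->
  Normc.normc (G (f t) i j) @[t --> +oo] --> (0 : R).
Proof.
move=> G0 hf.
have [k Gk] : exists k : {linear 'M[C]_(4 + 4, 4) -> 'M[C]_(p, q)},
    forall X, G X = k (dissipation_map X).
  apply: kernel_factorization => X FX.
  have [LX LLX] : commutator L X = 0 /\ commutator L (lindbladian H L X) = 0.
    by apply: eq_col_mx; rewrite col_mx0; exact: FX.
  exact: (G0 X LX (commutator_lindbladian_eq0 normL LX LLX)).
apply: rdot_cvg0_normc.
rewrite (_ : (fun t => _) = (fun t => rdot (k (dissipation_map (f t)))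
    (k (dissipation_map (f t))))); last by apply/funext => t; rewrite Gk.
apply: linear_rdot_cvg0.
rewrite (funext (fun t => rdot_col_mx (commutator L (f t))
                            (commutator L (lindbladian H L (f t))))).
have h1 := solution_commutator_cvg0 hf.
have h2 := solution_commutator_cvg0 (solution_lindbladian hf).
by have := cvgD h1 h2; rewrite addr0; exact.
Qed.

End Decay.

(** * Scalar attractors and assembly of the two statements *)

Section MainTheorem.
Context {R : realType}.
Local Notation C := R[i].

Definition swap_defect (X : 'M[C]_4) : 'M[C]_4 := swap *m X *m swap - X.

Lemma swap_defect_is_linear : linear swap_defect.
Proof.
move=> a X Y; rewrite /swap_defect; move: swap => S.
rewrite mulmxDr mulmxDl -scalemxAr -scalemxAl.
by rewrite opprD addrACA scalerBr.
Qed.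

HB.instance Definition _ :=
  GRing.isLinear.Build C 'M[C]_4 'M[C]_4 *:%R swap_defect swap_defect_is_linear.

Lemma adjmx_hamiltonian (E0 E1 : R) :
  adjmx (hamiltonian E0 E1) = hamiltonian E0 E1.
Proof.
rewrite hamiltonianE /adjmx tr_diag_mx map_diag_mx; congr diag_mx.
apply/rowP => j; rewrite !mxE charge_real -rmorphM -rmorphD.
exact: conjc_real.
Qed.

(** Scalars commute with [L] and [H], so for normal [L] they are stationary; the list containing
    only the eigenvalue 0 is a witness. *)
Lemma attractor_scalar (H L : 'M[C]_4) (c : C) :
  adjmx L *m L = L *m adjmx L -> attractor H L c%:M.
Proof.
move=> normL; exists [:: 0]; first by move=> l; rewrite inE => /eqP ->.
rewrite big_seq1 memv_ker add_lfunE opp_lfunE scale_lfunE scale0r subr0 lfunE.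
rewrite /= lindbladian_commuting //.
  by rewrite /commutator scalar_mxC subrr scaler0 oppr0.
by rewrite /commutator scalar_mxC subrr.
Qed.

Lemma density_scalar (c : C) : density (c%:M : 'M[C]_4) <-> c = 4^-1.
Proof.
have n4 : (4 : C) != 0 by rewrite pnatr_eq0.
split=> [[_]|->].
  rewrite mxtrace_scalar => h.
  by apply: (mulIf n4); rewrite mulVf // mulr_natr.
split; last by rewrite mxtrace_scalar -[LHS]mulr_natr mulVf.
move=> v; rewrite mul_mx_scalar -scalemxAl mxE mulr_ge0 ?invr_ge0 ?ler0n //.
rewrite mxE sumr_ge0 // => i _.
by rewrite adjmxE mulrC mulcJ_ge0.
Qed.

End MainTheorem.

Unset Implicit Arguments.

Theorem mainTheorem10 (R : realType) (E0 E1 : R) (L : 'M[R[i]]_4)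
    (hE : E0 - E1 != 0) :
  let H := hamiltonian E0 E1 in
  ((class1 0 L \/ class2 0 L) ->
    [/\ forall X : 'M[R[i]]_4, attractor H L X -> perm_invariant X,
        forall sigma : 'M[R[i]]_4,
          asymptotic_state H L sigma -> perm_invariant sigma &
        forall rho : R -> 'M[R[i]]_4,
          density (rho 0) -> trajectory H L rho ->
          forall i j : 'I_4,
            Normc.normc ((swap *m rho t *m swap - rho t) i j) @[t --> +oo] --> (0 : R)])
  /\
  ((class_theta (pi / 4) 0 L \/ class_theta (- (pi / 4)) 0 L) ->
    (forall X : 'M[R[i]]_4,
       attractor H L X /\ perm_invariant X <-> exists c : R[i], X = c%:M) /\
    (forall sigma : 'M[R[i]]_4,
       asymptotic_state H L sigma /\ perm_invariant sigma <->
       sigma = (4^-1)%:M)).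
Proof.
move=> H; have hermH : adjmx H = H := adjmx_hamiltonian E0 E1.
split=> [cL|cL].
  have normL : adjmx L *m L = L *m adjmx L.
    by case: cL => [/class1_normal|/class2_normal].
  have inv X : commutator L X = 0 -> commutator L (commutator H X) = 0 ->
      perm_invariant X.
    by case: cL => cL; [exact: class1_commutant | exact: class2_commutant].
  have att X : attractor H L X -> perm_invariant X.
    by move=> /(attractor_commuting hermH normL)[LX LHX]; exact: inv.
  split=> // [sigma [_] | rho _ traj i j]; first exact: att.
  (* Asymptotic permutation invariance is the decay of the linear map [swap_defect], which vanishes
     on the commutant by [inv]. *)
  apply: (solution_linear_cvg0 hermH normL (G := swap_defect)).
    by move=> X LX LHX; apply/eqP; rewrite subr_eq0; apply/eqP; exact: inv.
  by move=> t t0 k l; have [_ _] := traj k l; apply.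
have normL : adjmx L *m L = L *m adjmx L.
  by case: cL => /class_theta_normal.
have scal X : attractor H L X -> perm_invariant X -> exists c : R[i], X = c%:M.
  move=> /(attractor_commuting hermH normL)[LX LHX].
  by case: cL => cL; exact: class_theta_commutant cL LX LHX.
have inv (c : R[i]) : perm_invariant c%:M.
  by apply/perm_invariantP; rewrite scalar_mxC.
split=> [X|sigma]; split=> [[]|].
- exact: scal.
- by move=> [c ->]; split; [exact: attractor_scalar | exact: inv].
- move=> [ds att] /(scal _ att)[c sc]; move: ds; rewrite sc.
  by move=> /density_scalar ->.
- move=> ->; split; last exact: inv.
  by split; [exact/density_scalar | exact: attractor_scalar].
Qed.
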